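(* Let $\Gamma=\langle S\mid R\rangle$ be the Higman group, where $$S=\{a,b,c,d,a^{-1},b^{-1},c^{-1},d^{-1}\},$$ $$R=\{a^{-1}ba=b^{2},\ b^{-1}cb=c^{2},\ c^{-1}dc=d^{2},\ d^{-1}ad=a^{2}\}.$$ Then the Cayley graph $G=(V,E)$ of $\Gamma$ with respect to $S$ has no graph height function.
   Context: Cayley graphs: for a group $\Gamma$ with identity $\mathbf 1$ and a finite generating set $S$ with $S^{-1}=S$ and $\mathbf 1\notin S$, the Cayley graph is the simple graph with vertex-set $V=\Gamma$ and an undirected edge $\langle\gamma_1,\gamma_2\rangle$ if and only if $\gamma_2=\gamma_1 s$ for some $s\in S$. Graph height functions: let $G=(V,E)$ be an infinite, locally finite, connected, vertex-transitive simple graph with a distinguished vertex $\mathbf 1$ (the identity in the case of a Cayley graph), and let $\partial v$ denote the set of neighbours of $v$. For $\mathcal H\le\mathrm{Aut}(G)$, a function $F:V\to\mathbb R$ is $\mathcal H$-difference-invariant if $F(v)-F(w)=F(\gamma v)-F(\gamma w)$ for all $v,w\in V$ and $\gamma\in\mathcal H$. A subgroup of $\mathrm{Aut}(G)$ acts quasi-transitively if it has finitely many orbits on $V$. A graph height function on $G$ is a pair $(h,\mathcal H)$ where $\mathcal H\le\mathrm{Aut}(G)$ acts quasi-transitively on $G$ and $h:V\to\mathbb Z$ satisfies: (a) $h(\mathbf 1)=0$; (b) $h$ is $\mathcal H$-difference-invariant; (c) for every $v\in V$ there exist $u,w\in\partial v$ with $h(u)<h(v)<h(w)$. *)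

(* Defs.v *)
From HB Require Import structures.
From mathcomp Require Import all_boot all_algebra.
From mathcomp Require Import boolp classical_sets cardinality.
Set Implicit Arguments.
Unset Strict Implicit.
Unset Printing Implicit Defensive.

Local Open Scope classical_set_scope.
Local Open Scope quotient_scope.

(* The letter (x, false) stands for the generator x, and (x, true) for its
   formal inverse. *)
Definition word (X : choiceType) := seq (X * bool).

Definition word_inv (X : choiceType) (u : word X) : word X :=
  rev [seq (l.1, ~~ l.2) | l <- u].

Section Presentation.
Variables (X : choiceType) (R : set (word X * word X)).

(* The least congruence on words containing the relations u = v for (u, v) in R
   and the free cancellations, so that its classes form the group < X | R >. *)
Inductive pres_eq : word X -> word X -> Prop :=
| pres_refl u : pres_eq u u
| pres_sym u v : pres_eq u v -> pres_eq v u
| pres_trans u v w : pres_eq u v -> pres_eq v w -> pres_eq u w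
| pres_cat u u' v v' : pres_eq u u' -> pres_eq v v' -> pres_eq (u ++ v) (u' ++ v')
| pres_cancel x e : pres_eq [:: (x, e); (x, ~~ e)] [::]
| pres_rel u v : R (u, v) -> pres_eq u v.

Definition pres_eqb : rel (word X) := fun u v => `[< pres_eq u v >].

Lemma pres_eqb_refl : reflexive pres_eqb.
Proof. by move=> u; apply/asboolP; apply: pres_refl. Qed.

Lemma pres_eqb_sym : symmetric pres_eqb.
Proof. by move=> u v; apply/asboolP/asboolP; apply: pres_sym. Qed.

Lemma pres_eqb_trans : transitive pres_eqb.
Proof.
by move=> v u w /asboolP uv /asboolP vw; apply/asboolP; apply: pres_trans vw.
Qed.

Canonical pres_equiv := EquivRel pres_eqb pres_eqb_refl pres_eqb_sym pres_eqb_trans.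

Definition presented_group := {eq_quot pres_equiv}.


Lemma pres_piP (u v : word X) :
  \pi_presented_group u = \pi_presented_group v <-> pres_eq u v.
Proof. by split=> [/eqmodP/asboolP|h]; last by apply/eqmodP/asboolP. Qed.

Definition pres_one : presented_group := \pi_presented_group [::].
Definition pres_mul (g h : presented_group) : presented_group :=
  \pi_presented_group (repr g ++ repr h).
Definition pres_inv (g : presented_group) : presented_group :=
  \pi_presented_group (word_inv (repr g)).

Lemma pres_repr_pi (u : word X) : pres_eq (repr (\pi_presented_group u)) u.
Proof. by apply/pres_piP; rewrite reprK. Qed.

Lemma pres_mul_pi (u v : word X) :
  pres_mul (\pi_presented_group u) (\pi_presented_group v) =
  \pi_presented_group (u ++ v).
Proof. by apply/pres_piP; apply: pres_cat; apply: pres_repr_pi. Qed.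

Lemma pres_word_invK : involutive (@word_inv X).
Proof.
move=> u; rewrite /word_inv map_rev revK -map_comp -[RHS]map_id.
by apply: eq_map => -[x e] /=; rewrite negbK.
Qed.

Lemma pres_eq_catV (u : word X) : pres_eq (u ++ word_inv u) [::].
Proof.
elim: u => [|[x e] u IHu]; first exact: pres_refl.
rewrite /word_inv map_cons rev_cons -cats1 -/(word_inv u).
rewrite -cat1s -catA (catA u) /=.
apply: pres_trans (pres_cancel x e).
apply: (@pres_cat [:: (x, e)] [:: (x, e)]); first exact: pres_refl.
exact: (@pres_cat _ [::] _ [:: (x, ~~ e)] IHu (pres_refl _)).
Qed.

Lemma pres_mulA : associative pres_mul.
Proof.
move=> g h k; rewrite -(reprK g) -(reprK h) -(reprK k).
rewrite (pres_mul_pi (repr h)) (pres_mul_pi (repr g) (repr h)) !pres_mul_pi.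
by rewrite catA.
Qed.

Lemma pres_mul1g : left_id pres_one pres_mul.
Proof. by move=> g; rewrite -(reprK g) pres_mul_pi. Qed.

Lemma pres_mulg1 : right_id pres_one pres_mul.
Proof. by move=> g; rewrite -(reprK g) pres_mul_pi cats0. Qed.

Lemma pres_mulgV : right_inverse pres_one pres_inv pres_mul.
Proof.
move=> g; rewrite /pres_inv -{1}(reprK g) pres_mul_pi.
exact/pres_piP/pres_eq_catV.
Qed.

Lemma pres_mulVg : left_inverse pres_one pres_inv pres_mul.
Proof.
move=> g; rewrite /pres_inv -{2}(reprK g) pres_mul_pi.
by apply/pres_piP; rewrite -{2}(pres_word_invK (repr g)); apply: pres_eq_catV.
Qed.

HB.instance Definition _ := Choice.copy presented_group {eq_quot pres_equiv}.
HB.instance Definition _ := isGroup.Build presented_group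
  pres_mulA pres_mul1g pres_mulg1 pres_mulVg pres_mulgV.

Definition pres_gen (x : X) : presented_group := \pi_presented_group [:: (x, false)].

End Presentation.

(* The generators a, b, c, d of the Higman group are 0, 1, 2, 3 : 'I_4. *)
Definition higman_letter (i : nat) : word 'I_4 := [:: (inord i, false)].

Definition higman_rels : set (word 'I_4 * word 'I_4) :=
  let a := higman_letter 0 in let b := higman_letter 1 in
  let c := higman_letter 2 in let d := higman_letter 3 in
  [set (word_inv a ++ b ++ a, b ++ b);
       (word_inv b ++ c ++ b, c ++ c);
       (word_inv c ++ d ++ c, d ++ d);
       (word_inv d ++ a ++ d, a ++ a)].

Definition higman : groupType := presented_group higman_rels.

Definition higman_gens : set higman :=
  let a := pres_gen higman_rels (inord 0) in
  let b := pres_gen higman_rels (inord 1) in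
  let c := pres_gen higman_rels (inord 2) in
  let d := pres_gen higman_rels (inord 3) in
  [set a; b; c; d; a^-1; b^-1; c^-1; d^-1]%g.

Definition cayley (G : groupType) (S : set G) (g1 g2 : G) : Prop :=
  exists2 s, S s & g2 = (g1 * s)%g.

Section GraphHeight.
Variables (V : Type) (adj : V -> V -> Prop).

Definition graph_aut : set (V -> V) :=
  [set f | bijective f /\ forall u v, adj (f u) (f v) <-> adj u v].

Record aut_subgroup (H : set (V -> V)) : Prop := {
  aut_subgroup_sub : H `<=` graph_aut;
  aut_subgroup_id : H id;
  aut_subgroup_comp : forall f g, H f -> H g -> H (f \o g);
  aut_subgroup_inv : forall f g, H f -> cancel f g -> cancel g f -> H g }.

Definition aut_orbit (H : set (V -> V)) (v : V) : set V := [set f v | f in H].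

Definition quasi_transitive (H : set (V -> V)) : Prop :=
  finite_set (range (aut_orbit H)).

Local Open Scope ring_scope.

Definition difference_invariant (M : zmodType) (H : set (V -> V)) (F : V -> M) :=
  forall f, H f -> forall v w, F v - F w = F (f v) - F (f w).

Record graph_height_function (root : V) (h : V -> int) (H : set (V -> V)) : Prop := {
  ghf_subgroup : aut_subgroup H;
  ghf_quasi_transitive : quasi_transitive H;
  ghf_root : h root = 0;
  ghf_invariant : difference_invariant H h;
  ghf_neighbours :
    forall v, exists u w, [/\ adj v u, adj v w, h u < h v & h v < h w] }.

End GraphHeight.

(* Main.v *)
Require Import Defs.
From Stdlib Require Import Reals Lra ZArith.
From mathcomp Require Import all_boot all_order all_algebra cyclic.
From mathcomp Require Import boolp classical_sets cardinality.
Set Implicit Arguments.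
Unset Strict Implicit.
Unset Printing Implicit Defensive.

(** The Cayley graph of the Higman group is so rigid that its automorphisms are
the left translations composed with the four cyclic rotations of the generators.
A quasi-transitive group of automorphisms then contains a finite-index group of
translations, and since the Higman group has no proper finite-index subgroup the
height is invariant under all translations.  It is thus a homomorphism to the
integers, which vanishes because the relations give h(x_(i+1)) = 2 h(x_(i+1)).

Rigidity is read off the pentagons of the graph, so the crucial point is that the
only closed non-backtracking walks of length five are the relators ([trivial5]).
This needs a model of the group in which words can be seen to act nontrivially.
Take the free product of two copies of the additive group of the reals, its elements
written as alternating products of a^s and c^p.  Let a and c act by left
multiplication by a^1 and c^1.  Let b fix the empty word and rescale the exponents
of the c^p according to b^q a^s = a^s b^(q 2^s) and b^q c^p = c^(p 2^(-q)) b^q;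
d is the same with the two factors exchanged.  Each generator lies in a
one-parameter flow, and the four relations are instances of the single commutation
rule [flow_rel].  Three observations on this action detect nontrivial words:
a word in which some generator occurs exactly once is nontrivial
([ev_occurs_once]); nonempty reduced words in a and c move the empty word ([ev_free]);
and a and b act on suitable points as the affine group BS(1,2) ([ev_bs]).  Up to
the rotation of the generators, these criteria reject every cyclically reduced
word of length five other than the relators, as a finite computation shows.

Around a vertex, two distinct directions out of eight span a pentagon unless their
generators are opposite on the four-cycle a, b, c, d.  An automorphism preserves
this relation, hence preserves pairs of inverse directions ([label_straight]), and
the shape x_i^-1 y x_i y^-2 of a pentagon then forces orientations and the cyclic
order of the generators to be preserved as well ([graph_aut_twist]).

The last ingredient replaces finite quotients by exponents.  If the M-th powers of
the generators lie in a normal subgroup N, then conjugation by x_i^M shows that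
the powers with exponent 2^M - 1 do too; so does the power with exponent
gcd(M, 2^M - 1).  Since M divides 2^M - 1 only for M = 1, descent on M puts all
the generators in N ([higman_periodic_quotient]). *)

(** * An action on a free product of two real lines *)

Delimit Scope R_scope with real.

Definition exp2 (r : R) : R := Rpower 2 r.

Lemma exp2D r s : exp2 (r + s) = (exp2 r * exp2 s)%real.
Proof. exact: Rpower_plus. Qed.

Lemma exp20 : exp2 0 = 1%real.
Proof. by apply: Rpower_O; lra. Qed.

Lemma exp21 : exp2 1 = 2%real.
Proof. by apply: Rpower_1; lra. Qed.

Lemma exp2_gt0 r : (0 < exp2 r)%real.
Proof. exact: exp_pos. Qed.

Lemma exp2_inj r s : exp2 r = exp2 s -> r = s.
Proof.
move=> /(congr1 ln); rewrite /exp2 !ln_Rpower => E.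
by apply: Rmult_eq_reg_r E _; have := ln_lt_2; lra.
Qed.

(** A reduced word of the free product R * R, read from the left: the pair
(true, s) is the syllable a^s and (false, p) is c^p. *)
Definition syllables := seq (bool * R).

Definition starts (t : bool) (l : syllables) : bool :=
  if l is (t', _) :: _ then t' == t else false.

Fixpoint reduced (l : syllables) : Prop :=
  if l is (t, p) :: l' then [/\ p <> 0%real, ~~ starts t l' & reduced l'] else True.

(** Putting a syllable in front, where exponent 0 stands for no syllable.  With
this convention every reduced word has the form [push t p l] for each factor t
([pushP]), which avoids distinguishing cases by the first syllable. *)
Definition push (t : bool) (p : R) (l : syllables) : syllables :=
  if Req_EM_T p 0 then l else (t, p) :: l.

Definition lmul (t : bool) (p : R) (l : syllables) : syllables :=
  if l is (t', q) :: l' then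
    if t' == t then push t (p + q) l' else push t p l
  else push t p l.

(** The action of b^q (for t = false) and d^q (for t = true): moving the power
rightwards through the word, it rescales the syllables of the factor t, and is
itself rescaled by the syllables of the other factor. *)
Fixpoint scale (t : bool) (q : R) (l : syllables) : syllables :=
  if l is (t', p) :: l' then
    if t' == t then (t', p * exp2 (- q))%real :: scale t q l'
    else (t', p) :: scale t (q * exp2 p) l'
  else [::].

Lemma push0 t l : push t 0 l = l.
Proof. by rewrite /push; case: Req_EM_T. Qed.

Lemma pushN0 t p l : p <> 0%real -> push t p l = (t, p) :: l.
Proof. by rewrite /push; case: Req_EM_T. Qed.

Lemma reduced_push t p l : ~~ starts t l -> reduced l -> reduced (push t p l).
Proof. by rewrite /push; case: Req_EM_T. Qed.

Lemma pushP t l : reduced l ->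
  exists p l', [/\ l = push t p l', ~~ starts t l' & reduced l'].
Proof.
case: l => [|[t' p] l] /=; first by exists 0%real, [::]; rewrite push0.
case: (t' =P t) => [-> [p0 tl rl]|nt [p0 tl rl]].
  by exists p, l; rewrite pushN0.
by exists 0%real, ((t', p) :: l); rewrite push0 /=; split=> //; apply/eqP.
Qed.

Lemma lmul_push t p q l : ~~ starts t l -> lmul t p (push t q l) = push t (p + q) l.
Proof.
move=> tl; case: (Req_EM_T q 0) => [->|q0]; last by rewrite pushN0 //= eqxx.
rewrite push0 Rplus_0_r; case: l tl => [|[t' p'] l] //=.
by case: eqP.
Qed.

Lemma reduced_lmul t p l : reduced l -> reduced (lmul t p l).
Proof.
by case/(pushP t) => q [l' [-> tl rl]]; rewrite lmul_push //; apply: reduced_push.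
Qed.

Lemma lmulD t p q l : reduced l -> lmul t p (lmul t q l) = lmul t (p + q) l.
Proof.
by case/(pushP t) => s [l' [-> tl rl]]; rewrite !lmul_push // Rplus_assoc.
Qed.

Lemma lmul0 t l : reduced l -> lmul t 0 l = l.
Proof. by case/(pushP t) => s [l' [-> tl rl]]; rewrite lmul_push // Rplus_0_l. Qed.

Lemma starts_scale t' t q l : starts t' (scale t q l) = starts t' l.
Proof. by case: l => [|[s p] l] //=; case: (s == t). Qed.

Lemma reduced_scale t q l : reduced l -> reduced (scale t q l).
Proof.
elim: l q => [|[s p] l IHl] q //= [p0 sl rl].
have e0 := exp2_gt0 (- q).
case: eqP => _ /=; rewrite starts_scale; split=> //; try exact: IHl.
by apply: Rmult_integral_contrapositive; split=> //; lra.
Qed.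

Lemma scaleD t q r l : scale t q (scale t r l) = scale t (q + r) l.
Proof.
elim: l q r => [|[s p] l IHl] q r //=.
case: (s =P t) => [->|/eqP/negbTE nst] /=; rewrite ?eqxx ?nst IHl.
  by congr ((_, _) :: _); rewrite Ropp_plus_distr exp2D; lra.
by rewrite Rmult_plus_distr_r.
Qed.

Lemma scale0 t l : scale t 0 l = l.
Proof.
elim: l => [|[s p] l IHl] //=; rewrite Ropp_0 exp20 Rmult_0_l Rmult_1_r IHl.
by case: eqP.
Qed.

Lemma scale_push t q p l : scale t q (push t p l) = push t (p * exp2 (- q)) (scale t q l).
Proof.
case: (Req_EM_T p 0) => [->|p0]; first by rewrite Rmult_0_l !push0.
rewrite !pushN0 //= ?eqxx //.
by have := exp2_gt0 (- q) => e0; apply: Rmult_integral_contrapositive; split=> //; lra.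
Qed.

Lemma scale_push_neq t t' q p l : t' != t ->
  scale t q (push t' p l) = push t' p (scale t (q * exp2 p) l).
Proof.
move=> /negbTE nt; case: (Req_EM_T p 0) => [->|p0].
  by rewrite exp20 Rmult_1_r !push0.
by rewrite !pushN0 //= nt.
Qed.

Lemma lmul_scale t q p l : reduced l ->
  lmul t p (scale t q l) = scale t q (lmul t (p * exp2 q) l).
Proof.
case/(pushP t) => s [l' [-> tl rl]].
rewrite scale_push !lmul_push ?starts_scale // scale_push.
have : (exp2 q * exp2 (- q) = 1)%real by rewrite -exp2D Rplus_opp_r exp20.
by move=> e; congr push; rewrite Rmult_plus_distr_r Rmult_assoc e Rmult_1_r.
Qed.

Lemma scale_lmul_neq t t' q p l : t' != t -> reduced l ->
  scale t q (lmul t' p l) = lmul t' p (scale t (q * exp2 p) l).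
Proof.
move=> nt /(pushP t') [s [l' [-> tl rl]]].
rewrite lmul_push // !scale_push_neq // lmul_push ?starts_scale //.
by rewrite exp2D Rmult_assoc.
Qed.

(** The one-parameter group whose value at r = 1 is the action of the generator of
index n modulo 4. *)
Definition flow (n : nat) (r : R) : syllables -> syllables :=
  match n %% 4 with
  | 0 => lmul true r
  | 1 => scale false r
  | 2 => lmul false r
  | _ => scale true r
  end.

Lemma flow_mod n r : flow (n %% 4) r = flow n r.
Proof. by rewrite /flow modn_mod. Qed.

Lemma reduced_flow n r l : reduced l -> reduced (flow n r l).
Proof.
rewrite -flow_mod.
case: (n %% 4) (ltn_pmod n (isT : 0 < 4)) => [|[|[|[|//]]]] _;
  first [exact: reduced_lmul|exact: reduced_scale].
Qed.

Lemma flowD n r s l : reduced l -> flow n r (flow n s l) = flow n (r + s) l.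
Proof.
rewrite -!(flow_mod n).
case: (n %% 4) (ltn_pmod n (isT : 0 < 4)) => [|[|[|[|//]]]] _ rl;
  first [exact: lmulD|exact: scaleD].
Qed.

Lemma flow0 n l : reduced l -> flow n 0 l = l.
Proof.
rewrite -!(flow_mod n).
case: (n %% 4) (ltn_pmod n (isT : 0 < 4)) => [|[|[|[|//]]]] _ rl;
  first [exact: lmul0|exact: scale0].
Qed.

(** The interpolation of the Higman relation to real exponents.  At n = 0 and 2
it says how [scale] crosses a syllable of the other factor, at n = 1 and 3 how it
rescales a syllable of its own. *)
Lemma flow_rel n r s l : reduced l ->
  flow n.+1 r (flow n s l) = flow n s (flow n.+1 (r * exp2 s) l).
Proof.
rewrite -!(flow_mod n.+1) -addn1 -(modnDml n) !flow_mod -!(flow_mod n).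
case: (n %% 4) (ltn_pmod n (isT : 0 < 4)) => [|[|[|[|//]]]] _ rl; rewrite /flow /=;
  first [exact: lmul_scale|exact: scale_lmul_neq].
Qed.

(** A generator is encoded by any natural number with the right residue modulo 4,
so that the index can be shifted freely; the boolean marks an inverse. *)
Definition letter := (nat * bool)%type.

Definition sgn (e : bool) : R := if e then (-1)%real else 1%real.

Definition step (l : letter) (x : syllables) := flow l.1 (sgn l.2) x.

Definition act (w : seq letter) (x : syllables) := foldr step x w.

Lemma sgnN e : (sgn e + sgn (~~ e) = 0)%real.
Proof. by case: e; rewrite /sgn /=; lra. Qed.

Lemma act_cons l w x : act (l :: w) x = step l (act w x).
Proof. by []. Qed.

Lemma act_cat u v x : act (u ++ v) x = act u (act v x).
Proof. exact: foldr_cat. Qed.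

(** * Words in the Higman group *)

Definition flip (l : letter) : letter := (l.1, ~~ l.2).

Definition rotl (k : nat) (l : letter) : letter := ((l.1 + k) %% 4, l.2).

Definition ord_letter (l : letter) : 'I_4 * bool := (inord (l.1 %% 4), l.2).

Definition ev (w : seq letter) : higman :=
  \pi_(presented_group higman_rels)%qT (map ord_letter w).

Lemma ev_cat u v : ev (u ++ v) = (ev u * ev v)%g.
Proof. by rewrite /ev map_cat -pres_mul_pi. Qed.

Lemma ev_cons l w : ev (l :: w) = (ev [:: l] * ev w)%g.
Proof. exact: (ev_cat [:: l]). Qed.

Lemma ev_nil : ev [::] = 1%g.
Proof. by []. Qed.

Lemma ev_flip l : ev [:: flip l] = (ev [:: l])^-1%g.
Proof.
apply: (mulgI (ev [:: l])); rewrite mulgV -ev_cons -ev_nil.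
by apply/pres_piP; exact: pres_cancel.
Qed.

Lemma ev_modn n e : ev [:: (n %% 4, e)] = ev [:: (n, e)].
Proof. by rewrite /ev /= /ord_letter /= modn_mod. Qed.

Lemma higman_relP n :
  ev [:: (n, true); (n.+1, false); (n, false)] = ev [:: (n.+1, false); (n.+1, false)].
Proof.
apply/pres_piP; apply: pres_rel; rewrite /= /ord_letter /=.
have ->: n.+1 %% 4 = (n %% 4).+1 %% 4 by rewrite -addn1 -modnDml addn1.
case: (n %% 4) (ltn_pmod n (isT : 0 < 4)) => [|[|[|[|//]]]] _.
- by left; left; left.
- by left; left; right.
- by left; right.
- by right.
Qed.

Definition nat_letter (l : 'I_4 * bool) : letter := (val l.1, l.2).

Lemma ord_letterK l : nat_letter (ord_letter l) = (l.1 %% 4, l.2).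
Proof. by rewrite /nat_letter /= inordK // ltn_mod. Qed.

Lemma nat_letterK l : ord_letter (nat_letter l) = l.
Proof.
case: l => i e; rewrite /ord_letter /= modn_small ?ltn_ord //; congr pair.
exact: inord_val.
Qed.

Section Action.
Variables (T : Type) (P : T -> Prop) (s : letter -> T -> T).
Hypothesis sP : forall l x, P x -> P (s l x).
Hypothesis s_mod : forall n e x, s (n %% 4, e) x = s (n, e) x.
Hypothesis s_flip : forall n e x, P x -> s (n, e) (s (n, ~~ e) x) = x.
Hypothesis s_rel : forall n x, P x ->
  s (n, true) (s (n.+1, false) (s (n, false) x)) = s (n.+1, false) (s (n.+1, false) x).

Lemma action_closed w x : P x -> P (foldr s x w).
Proof. by move=> Px; elim: w => //= l w; apply: sP. Qed.

(** Any operation of letters that is invertible and obeys the four relations on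
an invariant subset P factors through the presented group there. *)
Lemma pres_eq_action u v : pres_eq higman_rels u v ->
  forall x, P x -> foldr s x (map nat_letter u) = foldr s x (map nat_letter v).
Proof.
elim=> {u v} [//|u v _ IH|u v w _ IHu _ IHv|u u' v v' _ IHu _ IHv|i e|u v Ruv] x Px.
- by rewrite IH.
- by rewrite IHu // IHv.
- rewrite !map_cat !foldr_cat IHv // IHu //; exact: action_closed.
- exact: s_flip.
- have s4 y : s (0, false) y = s (4, false) y by rewrite -(s_mod 4).
  case: Ruv => [[[]|]|] [-> ->]; rewrite /= /nat_letter /= !inordK //.
  + exact: s_rel.
  + exact: s_rel.
  + exact: s_rel.
  + by rewrite !s4; exact: s_rel.
Qed.

Lemma ev_action u v : ev u = ev v -> forall x, P x -> foldr s x u = foldr s x v.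
Proof.
have E w x : foldr s x w = foldr s x (map nat_letter (map ord_letter w)).
  by elim: w => //= -[n e] w ->; rewrite ord_letterK s_mod.
move=> uv x Px.
have uv' : pres_eq higman_rels (map ord_letter u) (map ord_letter v).
  move: uv; rewrite /ev.
  by case: (pres_piP higman_rels (map ord_letter u) (map ord_letter v)).
by rewrite (E u) (E v); apply: pres_eq_action uv' x Px.
Qed.
End Action.

Lemma ev_act u v x : ev u = ev v -> reduced x -> act u x = act v x.
Proof.
move=> uv rx; apply: (ev_action (P := reduced)) uv x rx.
- by move=> l x; apply: reduced_flow.
- by move=> n e x; rewrite /step flow_mod.
- by move=> n e x rx; rewrite /step flowD //= sgnN flow0.
- move=> n x rx; rewrite /step /= flow_rel // flowD; last exact: reduced_flow.
  rewrite flowD //; have ->: (sgn true + sgn false = 0)%real by rewrite /sgn; lra.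
  rewrite flow0; last exact: reduced_flow.
  by congr flow; rewrite /sgn exp21; lra.
Qed.

(** The relations are permuted cyclically by a shift of indices, so the shift
induces an automorphism of the group. *)
Lemma ev_rotl k u v : ev u = ev v -> ev (map (rotl k) u) = ev (map (rotl k) v).
Proof.
pose s (l : letter) (g : higman) := (ev [:: rotl k l] * g)%g.
have E w : ev (map (rotl k) w) = foldr s 1%g w.
  by elim: w => //= l w IHw; rewrite ev_cons IHw.
move=> uv; rewrite !E; apply: (ev_action (P := fun=> True)) uv _ _ => //.
- by move=> n e x; rewrite /s /rotl /= modnDml.
- by move=> n e x _; rewrite /s (ev_flip (rotl k (n, e))) mulVKg.
- move=> n x _; rewrite /s !mulgA /rotl /= !ev_modn.
  by congr (_ * _)%g; rewrite -mulgA -!ev_cons addSn; exact: higman_relP.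
Qed.

Lemma ev1_rotl k u : ev u = 1%g -> ev (map (rotl k) u) = 1%g.
Proof. exact: (@ev_rotl k u [::]). Qed.

(** * Criteria for words to be nontrivial *)

Lemma lmul_cat t p (l r : syllables) : 0 < size l -> lmul t p (l ++ r) = lmul t p l ++ r.
Proof.
case: l => // -[t' q] l _ /=; rewrite /push.
by case: eqP => _; case: Req_EM_T.
Qed.

Lemma size_lmul t p l : (size l).-1 <= size (lmul t p l).
Proof.
case: l => // -[t' q] l /=; rewrite /push.
case: eqP => _; case: Req_EM_T => _ //=; by rewrite ltnW.
Qed.

Lemma size_scale t q l : size (scale t q l) = size l.
Proof. by elim: l q => // -[t' p] l IHl q /=; case: eqP => _ /=; rewrite IHl. Qed.

Lemma scale_cat t q (l r : syllables) : exists q',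
  (q <> 0%real -> q' <> 0%real) /\ scale t q (l ++ r) = scale t q l ++ scale t q' r.
Proof.
elim: l q => [|[t' p] l IHl] q /=; first by exists q.
case: eqP => _.
  by have [q' [q'0 ->]] := IHl q; exists q'.
have [q' [q'0 ->]] := IHl (q * exp2 p)%real; exists q'; split=> // q0; apply: q'0.
by apply: Rmult_integral_contrapositive; split=> //; have := exp2_gt0 p; lra.
Qed.

(** A letter a, b or c can remove a syllable at the front of a word, but it cannot
alter a last syllable a^r that has others before it, whereas d always rescales it. *)
Definition ends_with (m : nat) (r : R) (x : syllables) :=
  exists l, x = rcons l (true, r) /\ m <= size l.

Lemma ends_with_step l m r x : l.1 < 3 ->
  ends_with m.+1 r x -> ends_with m r (step l x).
Proof.
case: l => n e /= n3 [l [-> ml]]; rewrite /step /flow /= modn_small; last exact: ltnW.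
have l0 : 0 < size l by apply: leq_trans ml.
case: n n3 => [|[|[|//]]] _; rewrite -!cats1.
- rewrite lmul_cat //; exists (lmul true (sgn e) l); rewrite cats1; split=> //.
  by apply: leq_trans (size_lmul _ _ _); rewrite -ltnS prednK.
- have [q' [_ ->]] := scale_cat false (sgn e) l [:: (true, r)].
  by exists (scale false (sgn e) l); rewrite cats1 size_scale; split=> //; exact: ltnW.
- rewrite lmul_cat //; exists (lmul false (sgn e) l); rewrite cats1; split=> //.
  by apply: leq_trans (size_lmul _ _ _); rewrite -ltnS prednK.
Qed.

Lemma ends_with_act w m r x : all (fun l => l.1 < 3) w ->
  ends_with (size w + m) r x -> ends_with m r (act w x).
Proof.
elim: w m => //= l w IHw m /andP[l3 w3]; rewrite addSnnS => /(IHw _ w3).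
exact: ends_with_step.
Qed.

Lemma ends_with_step3 e m r x : r <> 0%real ->
  ends_with m r x -> exists2 r', r' <> r & ends_with m r' (step (3, e) x).
Proof.
move=> r0 [l [-> ml]]; rewrite /step /flow /= -cats1.
have [q' [q'0 ->]] := scale_cat true (sgn e) l [:: (true, r)].
exists (r * exp2 (- q'))%real; last first.
  by exists (scale true (sgn e) l); rewrite size_scale /= cats1.
have : exp2 (- q') <> 1%real.
  rewrite -exp20 => /exp2_inj E; have : q' <> 0%real.
    by apply: q'0; case: (e); rewrite /sgn; lra.
  by lra.
by move=> ne E; apply: ne; apply: (Rmult_eq_reg_l r) => //; lra.
Qed.

(** Long enough words of this form keep their last syllable out of reach of a
given word in a, b and c. *)
Fixpoint alternating (m : nat) : syllables :=
  if m is m'.+1 then (~~ odd m, 1%real) :: alternating m' else [:: (true, 1%real)].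

Lemma reduced_alternating m : reduced (alternating m).
Proof.
elim: m => [|m IHm] /=; first by split=> //; lra.
by split; [lra|case: m {IHm} => //= m; case: odd|].
Qed.

Lemma ends_with_alternating m : ends_with m 1 (alternating m).
Proof.
elim: m => [|m [l [E ml]]]; first by exists [::].
by exists ((~~ odd m.+1, 1%real) :: l); rewrite /= E.
Qed.

Lemma ends_with_inj m m' r r' x : ends_with m r x -> ends_with m' r' x -> r = r'.
Proof. by move=> [l [-> _]] [l' [/rcons_inj[]]]. Qed.

Definition occurs_once (n : nat) (w : seq letter) := count (fun l => l.1 == n) w == 1.

Lemma count1_split (T : Type) (a : pred T) w : count a w = 1 ->
  exists u x v, [/\ w = u ++ x :: v, a x, ~~ has a u & ~~ has a v].
Proof.
elim: w => //= x w IHw; case ax: (a x) => /=.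
  by rewrite add1n => -[/eqP]; rewrite eqn0Ngt -has_count => nw; exists [::], x, w.
rewrite add0n => /IHw [u [y [v [-> ay nu nv]]]].
by exists (x :: u), y, v; rewrite /= ax.
Qed.

(** A single occurrence of d changes the last exponent of a long word in the free
product, and the other letters cannot change it back. *)
Lemma ev_occurs_once3 w : all (fun l => l.1 < 4) w -> occurs_once 3 w -> ev w <> 1%g.
Proof.
move=> w4 /eqP/count1_split [u [[n e] [v [E /= /eqP n3 nu nv]]]] evw.
move: w4; rewrite E all_cat /= n3 => /andP[u4 v4].
have lt3 z : all (fun l : letter => l.1 < 4) z -> ~~ has (fun l => l.1 == 3) z ->
    all (fun l => l.1 < 3) z.
  move=> z4; rewrite -all_predC => z3; apply/allP => l lz.
  by have := allP z4 _ lz; have /= := allP z3 _ lz; rewrite ltnS ltn_neqAle => ->.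
pose x := alternating (size v + size u).
have X : ends_with (size v + size u) 1 x := ends_with_alternating _.
have Xv := ends_with_act (lt3 _ v4 nv) X.
have [|r' r'1 Xe] := ends_with_step3 e _ Xv; first lra.
rewrite -[size u]addn0 in Xe.
have Xu := ends_with_act (lt3 _ u4 nu) Xe.
have rx : reduced x := reduced_alternating _.
have := @ev_act w [::] x evw rx; rewrite E act_cat n3 /= => F.
by rewrite F in Xu; apply: r'1; apply: ends_with_inj Xu X.
Qed.

Lemma ev_occurs_once n w : n < 4 -> all (fun l => l.1 < 4) w ->
  occurs_once n w -> ev w <> 1%g.
Proof.
(* The shift by 7 - n sends the index n to 3 modulo 4. *)
move=> n4 w4 wn /(ev1_rotl (7 - n)); apply: ev_occurs_once3.
  by rewrite all_map; apply/allP => l _ /=; rewrite ltn_mod.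
rewrite /occurs_once count_map; move: wn; congr (_ == 1).
apply: eq_in_count => -[m e] /(allP w4) /=; clear w4.
by move: n n4 m => [|[|[|[|//]]]] _ [|[|[|[|//]]]].
Qed.

Definition no_backtrack : rel letter := fun l l' => l' != flip l.

Definition free_word (w : seq letter) :=
  [&& w != [::], sorted no_backtrack w & all (fun l => ~~ odd l.1) w].

(** Ping-pong from the empty word: the first syllable of the image belongs to the
first letter of the acting word and its exponent has the sign of that letter, so it
cannot be cancelled by a letter that does not backtrack. *)
Lemma act_free l w : all (fun l => l.1 < 4) (l :: w) ->
  all (fun l : letter => ~~ odd l.1) (l :: w) -> sorted no_backtrack (l :: w) ->
  exists p x, act (l :: w) [::] = (l.1 == 0, p) :: x /\ (0 < p * sgn l.2)%real.
Proof.
elim: w l => [|l' w IHw] [n e].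
  rewrite /= !andbT => n4 on _; exists (sgn e), [::].
  rewrite /step /flow modn_small //=; split; last by case: (e); rewrite /sgn; lra.
  case: n n4 on => [|[|[|[|//]]]] // _ _ /=; rewrite pushN0 //;
    by case: (e); rewrite /sgn; lra.
rewrite act_cons => /andP[n4 w4] /andP[on ow] /andP[nl nw].
have [p [x [E pl]]] := IHw _ w4 ow nw.
rewrite {}E /step /flow /= modn_small //.
rewrite /= in n4 on.
case: l' nl {IHw nw} w4 ow pl => n' e' nl /andP[/= n'4 _] /andP[/= on' _] pl.
have s0 : sgn e <> 0%real by case: (e); rewrite /sgn; lra.
have ss : (0 < sgn e * sgn e)%real by case: (e); rewrite /sgn; lra.
case: (n' =P n) => [nn|nn].
  have ee : e' = e.
    by move: nl; rewrite /no_backtrack nn /flip; case: (e') (e) => [] [] //; rewrite eqxx.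
  exists (sgn e + p)%real, x; split; last by rewrite ee in pl; lra.
  have p0 : (sgn e + p)%real <> 0%real.
    by move: pl; rewrite ee; case: (e); rewrite /sgn; lra.
  by rewrite nn; case: n n4 on {nl nn} => [|[|[|[|//]]]] //= _ _; rewrite pushN0.
exists (sgn e), ((n' == 0, p) :: x); split=> //.
case: n n4 on nn {nl} => [|[|[|[|//]]]] //= _ _ nn;
  case: n' n'4 on' nn => [|[|[|[|//]]]] //= _ _ _;
  by rewrite pushN0.
Qed.

Lemma ev_free w : all (fun l => l.1 < 4) w -> free_word w -> ev w <> 1%g.
Proof.
case: w => // l w w4 /and3P[_ sw ow] evw.
have [p [x [E _]]] := act_free w4 ow sw.
by have := @ev_act (l :: w) [::] [::] evw I; rewrite E.
Qed.

(** The action of a and b on [bs_point], in coordinates: a translates the exponent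
n, and b adds 2^n to the second coordinate.  The exponent n is kept a natural
number, so n must start at least as high as the length of the word. *)
Definition bs_step (l : letter) (z : nat * Z) : nat * Z :=
  if l.1 == 0 then (if l.2 then z.1.-1 else z.1.+1, z.2)
  else (z.1, if l.2 then Z.sub z.2 (Z.pow 2 (Z.of_nat z.1))
             else Z.add z.2 (Z.pow 2 (Z.of_nat z.1))).

Definition bs_eval (k : nat) (w : seq letter) := foldr bs_step (k, Z0) w.

(** The word a^s c^p with p = 2^(-y); the logarithmic coordinate y turns the
rescaling by b into a translation. *)
Definition bs_point (s y : R) : syllables := lmul true s [:: (false, exp2 (- y))].

Lemma bs_point_inj s y s' y' : bs_point s y = bs_point s' y' -> s = s' /\ y = y'.
Proof.
rewrite /bs_point /= /push.
case: Req_EM_T => s0; case: Req_EM_T => s'0 //= [].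
  by move=> /exp2_inj; lra.
by move=> -> /exp2_inj; lra.
Qed.

Lemma exp2_INR n : exp2 (INR n) = IZR (Z.pow 2 (Z.of_nat n)).
Proof. by rewrite -pow_IZR -Rpower_pow //; lra. Qed.

Lemma act_bs k w : all (fun l : letter => l.1 < 2) w -> size w <= k ->
  act w (bs_point (INR k) 0) =
    bs_point (INR (bs_eval k w).1) (IZR (bs_eval k w).2)
  /\ k <= (bs_eval k w).1 + size w.
Proof.
elim: w => [|[n e] w IHw] /=; first by rewrite addn0.
move=> /andP[n2 w2] wk; have [-> k1] := IHw w2 (ltnW wk).
case: (bs_eval k w) k1 => m y /= k1.
have m0 : 0 < m.
  by move: wk k1; case: m => //; rewrite add0n => wk /(leq_trans wk); rewrite ltnn.
have r1 p : reduced [:: (false, exp2 p)] by split=> //; have := exp2_gt0 p; lra.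
rewrite /step /flow /bs_step /=; case: n n2 => [|[|//]] _ /=.
  rewrite lmulD //; split; last first.
    rewrite addnS -addSn; apply: leq_trans k1 _; rewrite leq_add2r.
    by case: e; [rewrite prednK|do 2!apply: ltnW].
  congr bs_point; case: e; rewrite /sgn; last by rewrite S_INR; lra.
  by rewrite -{1}(prednK m0) S_INR; lra.
rewrite (scale_lmul_neq _ _ (isT : true != false) (r1 _)).
rewrite addnS; split; last exact: ltnW.
rewrite /= -exp2D exp2_INR /bs_point /=; congr push; congr [:: (_, exp2 _)].
by case: e; rewrite /sgn ?minus_IZR ?plus_IZR; lra.
Qed.

Definition bs_word (w : seq letter) :=
  all (fun l => l.1 < 2) w &&
  ~~ (((bs_eval (size w) w).1 == size w) && Z.eqb (bs_eval (size w) w).2 0).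

Lemma ev_bs w : bs_word w -> ev w <> 1%g.
Proof.
move=> /andP[w2 /negP nw] evw; apply: nw.
have [E _] := act_bs w2 (leqnn _).
have r0 : reduced (bs_point (INR (size w)) 0).
  by apply: reduced_lmul; split=> //; have := exp2_gt0 (- 0); lra.
have := @ev_act w [::] _ evw r0; rewrite E => /bs_point_inj[/INR_eq -> /eq_IZR ->].
by rewrite eqxx.
Qed.

(** A computable sufficient criterion.  Rotations by 0 and 1 bring words in the
pairs a, c and b, d to words in a, c; the four rotations bring words in two
consecutive generators to words in a, b. *)
Definition nontrivial (w : seq letter) :=
  [|| has (occurs_once^~ w) (iota 0 4), has (fun k => free_word (map (rotl k) w)) (iota 0 2)
    | has (fun k => bs_word (map (rotl k) w)) (iota 0 4)].

Lemma nontrivialP w : all (fun l => l.1 < 4) w -> nontrivial w -> ev w <> 1%g.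
Proof.
move=> w4 /or3P[] /hasP[k]; rewrite mem_iota => /= k4 kw.
- exact: ev_occurs_once kw.
- move=> /(ev1_rotl k); apply: ev_free kw.
  by rewrite all_map; apply/allP => l _ /=; rewrite ltn_mod.
- by move=> /(ev1_rotl k); apply: ev_bs kw.
Qed.

(** * The pentagons of the Cayley graph *)

Definition letters : seq letter := [seq (n, e) | n <- iota 0 4, e <- [:: false; true]].

Definition relator (i : nat) : seq letter :=
  let x := (i, false) in let y := (i.+1 %% 4, false) in
  [:: y; x; flip y; flip y; flip x].

Definition relators : seq (seq letter) :=
  [seq rot j u | j <- iota 0 5,
     u <- map relator (iota 0 4) ++ map (fun i => rev (map flip (relator i))) (iota 0 4)].

Fixpoint words (n : nat) : seq (seq letter) :=
  if n is n'.+1 then [seq l :: w | l <- letters, w <- words n'] else [:: [::]].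

Lemma mem_letters l : (l \in letters) = (l.1 < 4).
Proof. by case: l => [[|[|[|[|n]]]] []]. Qed.

Lemma mem_words w : all (mem letters) w -> w \in words (size w).
Proof.
elim: w => [//|l w IHw] /andP[ll lw].
have lw' := IHw lw.
exact: (@allpairs_f _ _ _ cons letters (words (size w)) l w ll lw').
Qed.

Lemma words2_check : all (fun w => nontrivial w || (w == [:: nth (0, false) w 0;
  flip (nth (0, false) w 0)])) (words 2).
Proof. exact: (erefl true). Qed.

(** Three criteria suffice because a word of length five in which no generator occurs
exactly once involves at most two generators. *)
Lemma words5_check :
  all (fun w => cycle no_backtrack w ==> (nontrivial w || (w \in relators))) (words 5).
Proof. exact: (erefl true). Qed.

Lemma trivial5 w : size w = 5 -> all (mem letters) w -> cycle no_backtrack w ->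
  ev w = 1%g -> w \in relators.
Proof.
move=> w5 wl wc ev1; have := mem_words wl; rewrite w5.
move=> /(allP words5_check); rewrite wc /= => /orP[|//] /nontrivialP []//.
by apply/allP => l /(allP wl) /=; rewrite mem_letters.
Qed.

Lemma flipK : involutive flip.
Proof. by case=> n e; rewrite /flip /= negbK. Qed.

Lemma ev1_inj l l' : l \in letters -> l' \in letters -> ev [:: l] = ev [:: l'] -> l = l'.
Proof.
move=> ll ll' E.
have fl' : flip l' \in letters by move: ll'; rewrite !mem_letters.
have ev1 : ev [:: l; flip l'] = 1%g by rewrite ev_cons ev_flip E mulgV.
have := @mem_words [:: l; flip l'].
rewrite /= ll fl' => /(_ isT) /(allP words2_check) /orP[/nontrivialP []//|].
  by move: ll ll'; rewrite !mem_letters /= => -> ->.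
by move=> /eqP/(congr1 (fun w => nth (0, false) w 1))/(can_inj flipK)/esym.
Qed.

Lemma flip_letters l : (flip l \in letters) = (l \in letters).
Proof. by rewrite !mem_letters. Qed.

(** * Automorphisms of the Cayley graph *)

Lemma higman_gensP s : higman_gens s <-> exists2 l, l \in letters & s = ev [:: l].
Proof.
have inv (n : nat) : ((ev [:: (n, false)])^-1)%g = ev [:: (n, true)].
  by rewrite -ev_flip.
split=> [|[[n e]]].
  case=> [[[[[[[->|->]|->]|->]|->]|->]|->]|->].
  - by exists (0, false).
  - by exists (1, false).
  - by exists (2, false).
  - by exists (3, false).
  - by exists (0, true); rewrite // -inv.
  - by exists (1, true); rewrite // -inv.
  - by exists (2, true); rewrite // -inv.
  - by exists (3, true); rewrite // -inv.
rewrite mem_letters; case: n e => [|[|[|[|//]]]] [] _ ->; rewrite -?inv.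
- by do 3!left; right.
- by do 7!left.
- by do 2!left; right.
- by do 6!left; right.
- by left; right.
- by do 5!left; right.
- by right.
- by do 4!left; right.
Qed.

Notation higman_adj := (cayley higman_gens).

Lemma higman_adjP u v : higman_adj u v <->
  exists2 l, l \in letters & v = (u * ev [:: l])%g.
Proof.
split=> [[s /higman_gensP[l ll ->] ->]|[l ll ->]]; first by exists l.
by exists (ev [:: l]) => //; apply/higman_gensP; exists l.
Qed.

(** The direction of the image under f of the edge leaving v in direction l. *)
Definition label (f : higman -> higman) (v : higman) (l : letter) : letter :=
  nth (0, false) letters
    (find (fun l' => ev [:: l'] == ((f v)^-1 * f (v * ev [:: l]))%g) letters).

Lemma labelP f v l : graph_aut higman_adj f -> l \in letters ->
  label f v l \in letters /\ f (v * ev [:: l])%g = (f v * ev [:: label f v l])%g.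
Proof.
move=> [_ adjf] ll.
have : higman_adj (f v) (f (v * ev [:: l])%g) by apply/adjf/higman_adjP; exists l.
move=> /higman_adjP[l' ll' E].
pose a l' := ev [:: l'] == ((f v)^-1 * f (v * ev [:: l]))%g.
have h : has a letters by apply/hasP; exists l' => //; rewrite /a E mulKg.
split; first by rewrite mem_nth // -has_find.
by rewrite /label (eqP (nth_find (0, false) h)) mulVKg.
Qed.

Lemma label_uniq f v l l' : graph_aut higman_adj f -> l \in letters ->
  l' \in letters -> f (v * ev [:: l])%g = (f v * ev [:: l'])%g -> label f v l = l'.
Proof.
move=> autf ll ll' E; have [ml E'] := labelP v autf ll.
by apply: ev1_inj => //; apply: (mulgI (f v)); rewrite -E -E'.
Qed.

Lemma label_inj f v : graph_aut higman_adj f ->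
  {in letters &, injective (label f v)}.
Proof.
move=> autf l l' ll ll' E; apply: ev1_inj => //; apply: (mulgI v).
apply: (bij_inj autf.1).
by rewrite (labelP v autf ll).2 (labelP v autf ll').2 E.
Qed.

Lemma label_flip f v l : graph_aut higman_adj f -> l \in letters ->
  label f (v * ev [:: l])%g (flip l) = flip (label f v l).
Proof.
move=> autf ll; have [ml E] := labelP v autf ll.
apply: label_uniq; rewrite ?flip_letters //.
by rewrite E !ev_flip !mulgK.
Qed.

Fixpoint label_word (f : higman -> higman) (v : higman) (w : seq letter) : seq letter :=
  if w is l :: w' then label f v l :: label_word f (v * ev [:: l])%g w' else [::].

Lemma size_label_word f v w : size (label_word f v w) = size w.
Proof. by elim: w v => //= l w IHw v; rewrite IHw. Qed.

Lemma label_wordP f v w : graph_aut higman_adj f -> all (mem letters) w ->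
  all (mem letters) (label_word f v w) /\
  f (v * ev w)%g = (f v * ev (label_word f v w))%g.
Proof.
move=> autf; elim: w v => [|l w IHw] v /=; first by rewrite ev_nil !mulg1.
move=> /andP[ll lw]; have [ml E] := labelP v autf ll.
have [-> {}IHw] := IHw (v * ev [:: l])%g lw.
by rewrite ml (ev_cons l w) mulgA IHw E -mulgA -ev_cons.
Qed.

Lemma label_no_backtrack f v l l' : graph_aut higman_adj f ->
  l \in letters -> l' \in letters -> no_backtrack l l' ->
  no_backtrack (label f v l) (label f (v * ev [:: l])%g l').
Proof.
move=> autf ll ll'; rewrite /no_backtrack -label_flip //; apply: contra => /eqP E.
by apply/eqP; apply: (label_inj autf _ _ E); rewrite ?flip_letters.
Qed.

Lemma label_path f v l w : graph_aut higman_adj f -> all (mem letters) (l :: w) ->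
  path no_backtrack l w ->
  path no_backtrack (label f v l) (label_word f (v * ev [:: l])%g w).
Proof.
move=> autf; elim: w v l => [//|l' w IHw] v l /= /and3P[ll ll' lw] /andP[n nw].
by rewrite label_no_backtrack //= IHw //= ll' lw.
Qed.

Lemma label_word_rcons f v w l :
  label_word f v (rcons w l) = rcons (label_word f v w) (label f (v * ev w)%g l).
Proof.
elim: w v => [|l' w IHw] v /=; first by rewrite ev_nil mulg1.
by rewrite IHw (ev_cons l' w) mulgA.
Qed.

Lemma ev_inverse w : ev (rev (map flip w)) = ((ev w)^-1)%g.
Proof.
elim: w => [|l w IHw]; first by rewrite ev_nil invg1.
by rewrite /= rev_cons -cats1 ev_cat IHw ev_flip -invgM -ev_cons.
Qed.

Lemma ev1_rot j w : ev w = 1%g -> ev (rot j w) = 1%g.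
Proof.
rewrite -{1}(cat_take_drop j w) /rot !ev_cat => /mulg1_eq <-.
by rewrite mulVg.
Qed.

Lemma ev_relator i : ev (relator i) = 1%g.
Proof.
set x := (i, false); set y := (i.+1, false).
have E : ev (relator i) = ev [:: y; x; flip y; flip y; flip x].
  by rewrite /ev /= /ord_letter /= modn_mod.
have /(congr1 (fun g => ev [:: x] * g)%g) := higman_relP i.
rewrite (ev_cons (i, true)) (ev_flip x) mulVKg => E'.
rewrite E (ev_cat [:: y; x] [:: flip y; flip y; flip x]) E'.
by have := mulgV (ev [:: x; y; y]); rewrite -ev_inverse -ev_cons.
Qed.

Lemma ev_relators w : w \in relators -> ev w = 1%g.
Proof.
case/allpairsP => p [_ uR ->]; apply: ev1_rot.
move: uR; rewrite mem_cat => /orP[] /mapP[i _ ->]; first exact: ev_relator.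
by rewrite ev_inverse ev_relator invg1.
Qed.

Lemma relators_check : all (fun w => [&& all (mem letters) w, cycle no_backtrack w &
  size w == 5]) relators.
Proof. exact: (erefl true). Qed.

(** The image of a pentagon is a closed walk of length five without backtracking,
to which [trivial5] applies. *)
Lemma label_relator f v w : graph_aut higman_adj f -> w \in relators ->
  label_word f v w \in relators.
Proof.
move=> autf wr; have ev1 := ev_relators wr.
have /and3P[wl wc /eqP w5] := allP relators_check w wr.
have [wl' E] := label_wordP v autf wl.
apply: trivial5 => //; first by rewrite size_label_word.
  case: w wl wc ev1 {w5 wr wl' E} => [//|l w] wl wc ev1.
  have lw1 : all (mem letters) (rcons w l) by move: wl; rewrite /= all_rcons.
  have := @label_path f v l (rcons w l) autf.
  rewrite label_word_rcons -mulgA -ev_cons ev1 mulg1; apply=> //.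
  by rewrite -cat1s all_cat lw1 andbT; move: wl; rewrite /= andbT => /andP[].
by apply: (mulgI (f v)); rewrite -E ev1 !mulg1.
Qed.

(** The link of a vertex in the complex of pentagons, as a relation between
directions. *)
Definition angle (l l' : letter) : bool :=
  has (fun w => (head l w == l) && (last l' w == flip l')) relators.

Lemma label_angle f v l l' : graph_aut higman_adj f ->
  angle l l' -> angle (label f v l) (label f v l').
Proof.
move=> autf /hasP[w wr /andP[/eqP wl /eqP wl']].
apply/hasP; exists (label_word f v w); first exact: label_relator.
have ev1 := ev_relators wr.
have /and3P[/allP wL _ _] := allP relators_check w wr.
case/lastP: w wr wl wl' ev1 wL => [//|w z] wr wl wl' ev1 wL.
have zL : z \in letters by apply: wL; rewrite mem_rcons mem_head.
rewrite last_rcons in wl'; rewrite label_word_rcons last_rcons.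
apply/andP; split; last first.
  have := label_flip (v * ev w)%g autf zL.
  by rewrite -mulgA -ev_cat cats1 ev1 mulg1 wl' flipK => ->; rewrite flipK.
case: w wr wl {ev1 wL} => [|x w] wr /= wl; last by rewrite wl.
by have /and3P[_ _ /eqP] := allP relators_check _ wr.
Qed.

Lemma graph_aut_inv f : graph_aut higman_adj f ->
  exists2 f', graph_aut higman_adj f' & cancel f f' /\ cancel f' f.
Proof.
move=> [[f' fK f'K] adjf]; exists f' => //; split; first by exists f.
by move=> u v; rewrite -adjf !f'K.
Qed.

(** The inverse automorphism takes angles back, so non-angles are preserved too. *)
Lemma label_angleE f v l l' : graph_aut higman_adj f ->
  l \in letters -> l' \in letters -> angle (label f v l) (label f v l') = angle l l'.
Proof.
move=> autf ll ll'; have [f' autf' [fK f'K]] := graph_aut_inv autf.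
apply/idP/idP; last exact: label_angle.
have K m : m \in letters -> label f' (f v) (label f v m) = m.
  move=> mL; have [mL' E] := labelP v autf mL.
  by apply: label_uniq => //; rewrite -E !fK.
by move=> /(label_angle (f v) autf'); rewrite !K.
Qed.

(** The directions that span no angle with m are m itself and the two directions of
the opposite generator. *)
Lemma straight_check : all (fun m => all (fun l => all (fun l' =>
  [&& ~~ angle m l, ~~ angle m l', m != l, m != l' & l != l'] ==> (l' == flip l))
  letters) letters) letters.
Proof. exact: (erefl true). Qed.

Lemma opposite_check : all (fun l => has (fun m =>
  [&& ~~ angle m l, ~~ angle m (flip l), m != l, m != flip l & l != flip l])
  letters) letters.
Proof. exact: (erefl true). Qed.

(** The directions l and flip l span no angle with a direction m of the opposite
generator, so their images are the two directions spanning none with the image of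
m, and these are inverse to each other. *)
Lemma label_straight f v l : graph_aut higman_adj f -> l \in letters ->
  label f v (flip l) = flip (label f v l).
Proof.
move=> autf ll; have fl : flip l \in letters by rewrite flip_letters.
have /hasP[m ml /and5P[a1 a2 n1 n2 n3]] := allP opposite_check l ll.
have L x : x \in letters -> label f v x \in letters by move=> /(labelP v autf)[].
have N x y : x \in letters -> y \in letters -> x != y -> label f v x != label f v y.
  by move=> xl yl; apply: contra => /eqP /(label_inj autf xl yl) ->.
have := allP (allP (allP straight_check _ (L _ ml)) _ (L _ ll)) _ (L _ fl).
rewrite (label_angleE v autf ml ll) (label_angleE v autf ml fl) a1 a2.
by rewrite (N _ _ ml ll n1) (N _ _ ml fl n2) (N _ _ ll fl n3) => /implyP/(_ isT)/eqP.
Qed.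

(** A pentagon traverses exactly one straight angle, at its doubled edge y y.  With
this angle at the third vertex after the base, the base is an end of the edge y
opposite to it, from which x leaves in its positive direction; only the sign of y
remains free. *)
Lemma corner_check : all (fun w => (nth (0, false) w 2 == nth (0, false) w 3) ==>
  ((nth (0, false) w 4).2 && ((nth (0, false) w 0).1 == (nth (0, false) w 4).1.+1 %% 4)))
  relators.
Proof. exact: (erefl true). Qed.

Lemma relator_relators i : i < 4 -> relator i \in relators.
Proof. by move: i => [|[|[|[|//]]]]. Qed.

(** The image of the pentagon of [relator i] based at v is a pentagon whose straight
angle is at the third vertex after f v, so [corner_check] applies to it. *)
Lemma label_corner f v i : graph_aut higman_adj f -> i < 4 ->
  exists j, [/\ j < 4, label f v (i, false) = (j, false) &
    (label f v (i.+1 %% 4, false)).1 = j.+1 %% 4].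
Proof.
move=> autf i4; have R := label_relator v autf (relator_relators i4).
have := allP corner_check _ R.
have xl : (i, false) \in letters by rewrite mem_letters.
have yl : (i.+1 %% 4, false) \in letters by rewrite mem_letters ltn_mod.
move: R; rewrite /relator; set x := (i, false); set y := (_ %% 4, false).
move=> R; rewrite [label_word _ _ _]/=.
set u := (v * ev [:: y] * ev [:: x])%g; set u' := (u * ev [:: flip y])%g.
set v' := (u' * ev [:: flip y])%g.
have vE : (v' * ev [:: flip x])%g = v.
  by rewrite -!mulgA -!ev_cons (ev_relator i) mulg1.
have E2 : label f u' (flip y) = label f u (flip y).
  rewrite label_straight // -[y in LHS]flipK label_flip ?flip_letters //.
  by rewrite flipK.
have E4 : label f v x = flip (label f v' (flip x)).
  have fx : flip x \in letters by rewrite flip_letters.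
  by rewrite -(label_flip v' autf fx) vE flipK.
rewrite /= E2 eqxx /= => /andP[m4 /eqP m0].
exists (label f v' (flip x)).1; split=> //.
  by have := (labelP v autf xl).1; rewrite E4 mem_letters.
by rewrite E4 /flip m4.
Qed.

(** Each generator plays the role of x in one pentagon, which fixes its orientation,
and consecutive pairs have consecutive images. *)
Lemma label_rotl f v : graph_aut higman_adj f ->
  exists2 k, k < 4 & forall l, l \in letters -> label f v l = rotl k l.
Proof.
move=> autf; have [k [k4 E0 _]] := label_corner v autf (isT : 0 < 4).
have E i : i < 4 -> label f v (i, false) = rotl k (i, false).
  elim: i => [|i IHi] i4; first by rewrite E0 /rotl add0n modn_small.
  have [j [_ Ej Ej1]] := label_corner v autf (ltnW i4).
  have [j' [j4 Ej' _]] := label_corner v autf i4.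
  rewrite modn_small // Ej' /= in Ej1; rewrite Ej' Ej1 /rotl /=.
  move: Ej; rewrite IHi ?(ltnW i4) // => -[<-].
  by rewrite -addn1 modnDml addn1 addSn.
exists k => // -[i [|]]; rewrite mem_letters => i4; last exact: E.
by rewrite (label_straight v (l := (i, false))) ?mem_letters // E.
Qed.

Lemma modnD_inj i k k' : k < 4 -> k' < 4 -> (i + k) %% 4 = (i + k') %% 4 -> k = k'.
Proof. by move=> k4 k'4 /eqP; rewrite eqn_modDl !modn_small // => /eqP. Qed.

Lemma all_letters_ord w : all (mem letters) (map nat_letter w).
Proof.
by rewrite all_map; apply/allP => -[i e] _; rewrite /= mem_letters /= ltn_ord.
Qed.

Lemma evP_letters (g : higman) : exists2 w, all (mem letters) w & g = ev w.
Proof.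
exists (map nat_letter (repr (g : presented_group higman_rels))).
  exact: all_letters_ord.
by rewrite /ev mapK; [rewrite reprK|exact: nat_letterK].
Qed.

(** Up to the left translation by f 1, the map f is the rotation of the generators
by k. *)
Definition twist (k : nat) (f : higman -> higman) : Prop :=
  forall w, all (mem letters) w -> f (ev w) = (f 1 * ev (map (rotl k) w))%g.

(** The rotations at the two ends of an edge agree because they give the same image
to that edge, so one rotation serves the whole graph. *)
Theorem graph_aut_twist f : graph_aut higman_adj f -> exists2 k, k < 4 & twist k f.
Proof.
move=> autf; have [k k4 kE] := label_rotl 1%g autf; exists k => // w wl.
suff step v : (forall l, l \in letters -> label f v l = rotl k l) ->
    f (v * ev w)%g = (f v * ev (map (rotl k) w))%g.
  by rewrite -[ev w]mul1g step.
elim: w wl v => [|l w IHw] /=; first by move=> _ v _; rewrite ev_nil !mulg1.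
move=> /andP[ll lw] v vE; have [_ El] := labelP v autf ll.
rewrite (ev_cons l) mulgA IHw // => [|l' ll'].
  by rewrite El vE // -mulgA -ev_cons.
have [k' k'4 k'E] := label_rotl (v * ev [:: l])%g autf; rewrite k'E //.
have : rotl k' (flip l) = rotl k (flip l).
  by rewrite -k'E ?flip_letters // label_flip // vE.
by move=> [/modnD_inj ->].
Qed.

(** * Quotients of finite exponent *)

(** For p the least prime factor of n, the order of 2 modulo p would divide both n and
p - 1, which are coprime. *)
Lemma dvdn_exp2_pred n : 0 < n -> n %| (2 ^ n).-1 -> n = 1.
Proof.
move=> n0 dn; apply/eqP; rewrite eqn_leq n0 andbT leqNgt; apply/negP => n1.
set p := pdiv n; have pp : prime p := pdiv_prime n1.
have p0 : 0 < p := prime_gt0 pp.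
have pn : 2 ^ n = 1 %[mod p].
  apply/eqP; rewrite eqn_mod_dvd ?expn_gt0 // subn1.
  exact: dvdn_trans (pdiv_dvd n) dn.
have c2 : coprime 2 p.
  rewrite coprime_sym prime_coprime //; apply/negP => p2.
  have : p %| (2 ^ n).-1.+1 by rewrite prednK ?expn_gt0 // dvdn_exp.
  rewrite -addn1 dvdn_addr; last exact: dvdn_trans (pdiv_dvd n) dn.
  by rewrite dvdn1 => /eqP p1; move: pp; rewrite p1.
have pt : 2 ^ p.-1 = 1 %[mod p] by rewrite -totient_prime // Euler_exp_totient.
have g1 : gcdn n p.-1 = 1.
  apply/eqP; rewrite eqn_leq gcdn_gt0 n0 andbT leqNgt; apply/negP => g1.
  have p1 : 0 < p.-1 by rewrite -ltnS prednK // prime_gt1.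
  have := leq_trans (pdiv_min_dvd g1 (dvdn_gcdl _ _)) (dvdn_leq p1 (dvdn_gcdr _ _)).
  by rewrite -/p -ltnS prednK // ltnn.
have expM a b : 2 ^ a = 1 %[mod p] -> 2 ^ (b * a) = 1 %[mod p].
  by move=> E; rewrite mulnC expnM -modnXm E modnXm exp1n.
have [km kn E _] := egcdnP p.-1 n0.
have := expM _ km pn; rewrite E g1 expnD -modnMml (expM _ kn pt) modnMml mul1n.
move=> /eqP; rewrite expn1 eqn_mod_dvd // subn1 /= dvdn1 => /eqP p1.
by move: pp; rewrite p1.
Qed.

Definition gen (i : nat) : higman := ev [:: (i, false)].

Lemma gen_rel i : (gen i.+1 ^ gen i)%g = (gen i.+1 ^+ 2)%g.
Proof.
have := higman_relP i; rewrite (ev_cons (i, true)) (ev_flip (i, false)).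
by rewrite !(ev_cons (i.+1, false) [:: _]) expg2.
Qed.

Lemma gen_relX i n : (gen i.+1 ^ (gen i ^+ n))%g = (gen i.+1 ^+ (2 ^ n))%g.
Proof.
elim: n => [|n IHn]; first by rewrite expg0 conjg1 expg1.
by rewrite expgSr conjgM IHn conjXg gen_rel -expgnA -expnS.
Qed.

Lemma gen_pred i : gen i = gen (i + 3).+1.
Proof. by rewrite /gen -(ev_modn i) -(ev_modn (i + 3).+1) -addnS modnDr. Qed.

(** This is the classical argument that the Higman group has no nontrivial finite
quotient, with a common exponent M in place of the orders of the four generators. *)
Lemma higman_periodic_quotient (N : higman -> Prop) M :
  N 1%g -> (forall x y, N x -> N y -> N (x * y)%g) -> (forall x, N x -> N x^-1%g) ->
  (forall x y, N x -> N (x ^ y)%g) -> 0 < M -> (forall i, N (gen i ^+ M)%g) ->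
  forall i, N (gen i).
Proof.
move=> N1 NM NV NJ.
have NX x n : N x -> N (x ^+ n)%g.
  by move=> Nx; elim: n => [|n IHn]; rewrite ?expg0 // expgS; apply: NM.
have Ngcd x a b : 0 < a -> N (x ^+ a)%g -> N (x ^+ b)%g -> N (x ^+ gcdn a b)%g.
  move=> a0 Na Nb; have [ka kb E _] := egcdnP b a0.
  have := NM _ _ (NV _ (NX _ kb Nb)) (NX _ ka Na).
  by rewrite -!expgnA (mulnC a) (mulnC b) E expgnDr mulKg.
elim/ltn_ind: M => M IHM M0 NMg.
(* Modulo N, conjugation by the M-th power of gen j is trivial, but it also
   raises gen j.+1 to the power 2 ^ M. *)
have Npred i : N (gen i ^+ (2 ^ M).-1)%g.
  rewrite gen_pred; set j := i + 3.
  have := NM _ _ (NJ _ (gen j.+1) (NV _ (NMg j))) (NMg j).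
  rewrite conjgE -!mulgA -conjgE gen_relX.
  by rewrite -{1}(prednK (_ : 0 < 2 ^ M)) ?expn_gt0 // expgS mulKg.
have [E|ne] := eqVneq (gcdn M (2 ^ M).-1) M.
  have M1 : M = 1 by apply: dvdn_exp2_pred => //; rewrite -{1}E dvdn_gcdr.
  by move=> i; have := NMg i; rewrite M1 expg1.
(* Descent: the gcd is a smaller common exponent. *)
apply: (IHM (gcdn M (2 ^ M).-1)).
- by rewrite ltn_neqAle ne dvdn_leq ?dvdn_gcdl.
- by rewrite gcdn_gt0 M0.
- by move=> i; apply: Ngcd.
Qed.

(** * Heights *)

Section Height.
Variables (h : higman -> int) (H : set (higman -> higman)).
Hypothesis hH : graph_height_function higman_adj 1%g h H.

Definition periods (t : higman) : Prop :=
  forall v w, (h (t * v)%g - h (t * w)%g = h v - h w)%R.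

Lemma periods1 : periods 1%g.
Proof. by move=> v w; rewrite !mul1g. Qed.

Lemma periodsM x y : periods x -> periods y -> periods (x * y)%g.
Proof. by move=> px py v w; rewrite -!mulgA px py. Qed.

Lemma periodsV x : periods x -> periods x^-1%g.
Proof. by move=> px v w; rewrite -(px (x^-1 * v)%g) !mulVKg. Qed.

Lemma periodsX x n : periods x -> periods (x ^+ n)%g.
Proof.
move=> px; elim: n => [|n IHn]; first by rewrite expg0; apply: periods1.
by rewrite expgS; apply: periodsM.
Qed.

(** Two automorphisms in H with the same rotation differ by a left translation, and
both preserve the differences of h. *)
Lemma periods_twist k f1 f2 r : H f1 -> H f2 -> twist k f1 -> twist k f2 ->
  periods (f1 r / f2 r)%g.
Proof.
move=> H1 H2 t1 t2.
have E v : f1 v = (f1 r / f2 r * f2 v)%g.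
  have [w wl ->] := evP_letters v; have [u ul ->] := evP_letters r.
  by rewrite !t1 // !t2 // invgM !mulgA mulgK mulgVK.
move=> v w; have [f2' _ f2'K] := (aut_subgroup_sub (ghf_subgroup hH) H2).1.
rewrite -[v]f2'K -[w]f2'K -!E -(ghf_invariant hH H1).
by rewrite -(ghf_invariant hH H2).
Qed.

(** The translations preserving the differences of h form a subgroup of finite
index.  The finitely many cosets are told apart by an orbit of H and by the rotation
of an automorphism in H that reaches the given vertex from a base point of its
orbit. *)
Lemma periods_code : exists m (code : higman -> nat),
  (forall v, code v < m) /\ forall u v, code u = code v -> periods (u / v)%g.
Proof.
have /finite_seqP[s sE] := ghf_quasi_transitive hH.
pose r o := xget (1%g : higman) (nth set0 s o).
pose P v c := c < size s * 4 /\ exists f, [/\ H f, f (r (c %/ 4)) = v & twist (c %% 4) f].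
have [v|code codeP] := @choice _ _ P.
  have : range (aut_orbit H) (aut_orbit H v) by exists v.
  rewrite sE /= => os; set o := index (aut_orbit H v) s.
  have : aut_orbit H v (r o).
    rewrite /r nth_index //; apply: (@xgetI _ _ _ v).
    by exists id => //; exact: aut_subgroup_id (ghf_subgroup hH).
  case=> g Hg gv; have [g' gK g'K] := (aut_subgroup_sub (ghf_subgroup hH) Hg).1.
  have Hg' := aut_subgroup_inv (ghf_subgroup hH) Hg gK g'K.
  have [k k4 g't] := graph_aut_twist (aut_subgroup_sub (ghf_subgroup hH) Hg').
  (* The pair of the orbit o and the rotation k, packed into one number. *)
  exists (o * 4 + k); split.
    by rewrite -index_mem -/o in os; apply: (@leq_trans (o.+1 * 4));
      rewrite ?leq_mul2r ?os // mulSnr ltn_add2l.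
  exists g'; rewrite divnMDl // modnMDl divn_small // addn0 modn_small //.
  by split=> //; rewrite -gv gK.
exists (size s * 4), code; split=> [v|u v E]; first by have [] := codeP v.
have [_ [f1 [H1 e1 t1]]] := codeP u; have [_ [f2 [H2 e2 t2]]] := codeP v.
rewrite E in e1 t1.
by have := periods_twist (r (code v %/ 4)) H1 H2 t1 t2; rewrite e1 e2.
Qed.

(** Among the powers of g with exponents 0 to m, two lie in the same coset, so some
exponent of at most m works for g, and m! works for all elements.  This uniformity
lets the exponent pass to all conjugates below. *)
Lemma periods_exponent : exists2 M, 0 < M & forall g, periods (g ^+ M)%g.
Proof.
have [m [code [cm codeP]]] := periods_code.
exists m`!; first exact: fact_gt0.
move=> g; pose s := [seq code (g ^+ i)%g | i <- iota 0 m.+1].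
have /(uniqPn 0)[i [j []]] : ~~ uniq s.
  apply/negP => us; have := @uniq_leq_size _ s (iota 0 m) us.
  rewrite size_map !size_iota ltnn => F; have // : false; apply: F.
  by move=> _ /mapP[i _ ->]; rewrite mem_iota cm.
rewrite size_map size_iota => ij jm; rewrite !(nth_map 0) ?size_iota ?(ltn_trans ij) //.
rewrite !nth_iota ?(ltn_trans ij) // !add0n => /esym/codeP.
rewrite -expgnFr 1?ltnW // => p.
have d : j - i %| m`!.
  by apply: dvdn_fact; rewrite subn_gt0 ij (leq_trans (leq_subr _ _)).
by rewrite -(divnK d) mulnC expgnA; apply: periodsX.
Qed.

Lemma periods_all t : periods t.
Proof.
have [M M0 pM] := periods_exponent.
have pgen i : periods (gen i).
  (* The normal core of the group of periods. *)
  have := @higman_periodic_quotient (fun t => forall k, periods (t ^ k)%g) M.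
  move=> /(_ _ _ _ _ M0 _ i) Q; rewrite -(conjg1 (gen i)); apply: Q.
  - by move=> k; rewrite conj1g; exact: periods1.
  - by move=> x y px py k; rewrite conjMg; apply: periodsM.
  - by move=> x px k; rewrite conjVg; apply: periodsV.
  - by move=> x y px k; rewrite -conjgM.
  - by move=> j k; rewrite conjXg.
have [w _ ->] := evP_letters t; elim: w => [|[n e] w IHw]; first exact: periods1.
rewrite ev_cons; apply: periodsM => //; case: e; last exact: pgen.
by rewrite (ev_flip (n, false)); apply/periodsV/pgen.
Qed.

Lemma heightM x y : h (x * y)%g = (h x + h y)%R.
Proof.
have := periods_all x y 1%g; rewrite mulg1 (ghf_root hH) GRing.subr0 => <-.
by rewrite GRing.addrC GRing.subrK.
Qed.

Lemma height_gen i : h (gen i) = 0%R.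
Proof.
rewrite gen_pred; set j := i + 3.
have := congr1 h (conjgC (gen j.+1) (gen j)); rewrite gen_rel expg2 !heightM.
rewrite GRing.addrC => /GRing.addrI /eqP.
by rewrite -GRing.subr_eq0 GRing.opprD GRing.addrA GRing.subrr GRing.sub0r
  GRing.oppr_eq0 => /eqP.
Qed.

Lemma height_adj u v : higman_adj u v -> h v = h u.
Proof.
move=> /higman_adjP[[n e] _ ->]; rewrite heightM.
suff -> : h (ev [:: (n, e)]) = 0%R by rewrite GRing.addr0.
case: e; last exact: height_gen.
have := congr1 h (mulgV (gen n)).
by rewrite heightM height_gen GRing.add0r (ghf_root hH) -ev_flip.
Qed.

Lemma height_false : False.
Proof.
have [u [w [au _ lu _]]] := ghf_neighbours hH 1%g.
by move: lu; rewrite (height_adj au) Order.POrderTheory.ltxx.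
Qed.
End Height.

Theorem theorem8p1 :
  ~ exists (h : higman -> int) (H : set (higman -> higman)),
      graph_height_function (cayley higman_gens) (1%g : higman) h H.
Proof. by move=> [h [H hH]]; exact: height_false hH. Qed.
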